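(* Let $G$ be a (simple, undirected) graph on a totally ordered $n$-element vertex set. Let $X_G(\lambda)$ be its refined chromatic polynomial. Then \[X_G(-1)=(-1)^n\sum_O u^{\operatorname{des}(O)},\] where the sum is over all acyclic orientations $O$ of $G$.
   Context: For a positive integer $\lambda$, a proper $\lambda$-coloring of $G$ is a map $c$ from the vertex set to $\{1,\dots,\lambda\}$ with $c(i)\ne c(j)$ whenever $\{i,j\}$ is an edge. A descent of a proper coloring $c$ is an edge $\{i,j\}$ with $i<j$ and $c(i)>c(j)$; $\operatorname{des}(c)$ is their number. The refined chromatic polynomial $X_G(\lambda)$ is the unique polynomial in $\lambda$ with coefficients in $\mathbb{Z}[u]$ such that for every nonnegative integer $\lambda$, $X_G(\lambda)=\sum_c u^{\operatorname{des}(c)}$, the sum over all proper $\lambda$-colorings $c$ of $G$. An acyclic orientation $O$ of $G$ directs each edge so that there is no directed cycle; a descent of $O$ is a directed edge $(s,t)$ with $s>t$, and $\operatorname{des}(O)$ is their number.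
   Formalization: The refined chromatic polynomial is taken with coefficients in Q[u] rather than Z[u], since for a single edge it is (1+u)λ(λ−1)/2 and no such polynomial over Z[u] exists. *)

(* Defs.v *)
From HB Require Import structures.
From mathcomp Require Import all_boot all_order all_algebra.

Set Implicit Arguments.
Unset Strict Implicit.
Unset Printing Implicit Defensive.

Import Order.TTheory GRing.Theory Num.Theory.

Local Open Scope ring_scope.

Record sgraph (V : finType) := SGraph {
  adj :> rel V;
  adj_sym : symmetric adj;
  adj_irr : irreflexive adj
}.

Section Colorings.
Variables (d : Order.disp_t) (V : finOrderType d) (G : sgraph V).

(* The colors 1, ..., k are represented by the elements 0, ..., k - 1 of 'I_k. *)
Definition proper_coloring (k : nat) (c : {ffun V -> 'I_k}) : bool :=
  [forall i, forall j, G i j ==> (c i != c j)].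

(* An edge {i, j} is represented by the pair (i, j) with i < j. *)
Definition coloring_des (k : nat) (c : {ffun V -> 'I_k}) : nat :=
  #|[set p : V * V | [&& G p.1 p.2, (p.1 < p.2)%O & (c p.2 < c p.1)%N]]|.

Definition coloring_sum (k : nat) : {poly rat} :=
  \sum_(c : {ffun V -> 'I_k} | proper_coloring c) 'X^(coloring_des c).

(* {poly {poly rat}} is Q[u][lambda]. The coefficients are taken in Q[u]
   because they need not lie in Z[u]: for a single edge the polynomial is
   (1 + u) lambda (lambda - 1) / 2. *)
Definition is_refined_chromatic (X : {poly {poly rat}}) : Prop :=
  forall k : nat, X.[k%:R] = coloring_sum k.

End Colorings.

Section Orientations.
Variable V : finType.
Implicit Types (O : {set V * V}) (G : sgraph V).

(* O is the set of directed edges (s, t). *)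
Definition orientation G O : bool :=
  [forall s, forall t,
     (((s, t) \in O) ==> G s t)
     && (G s t ==> (((s, t) \in O) (+) ((t, s) \in O)))].

Definition arc O : rel V := [rel s t | (s, t) \in O].

(* There is no simple directed cycle; such a cycle has at most #|V| vertices. *)
Definition acyclic O : bool :=
  [forall m : 'I_#|V|, forall s : m.+1.-tuple V, ~~ ucycleb (arc O) s].

Lemma acyclicP O :
  reflect (forall s : seq V, cycle (arc O) s -> s = [::]) (acyclic O).
Proof.
apply: (iffP forallP) => [acO [//|x p] | acO m]; last first.
  apply/forallP => s; apply/negP => /andP[/acO s0 _].
  by have := size_tuple s; rewrite s0.
rewrite /cycle rcons_path => /andP[pathp].
case/shortenP: pathp => q pathq uniqq _ last_x.
have ltq : (size q < #|V|)%N.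
  by have := max_card (mem (x :: q)); rewrite (card_uniqP uniqq).
have /forallP/(_ (in_tuple (x :: q))) /= := acO (Ordinal ltq).
by rewrite /ucycleb uniqq andbT /cycle rcons_path pathq last_x.
Qed.

Definition acyclic_orientation G O : bool := orientation G O && acyclic O.

End Orientations.

Definition orientation_des (d : Order.disp_t) (V : finOrderType d)
    (O : {set V * V}) : nat :=
  #|[set p in O | (p.2 < p.1)%O]|.

Section RefinedChromatic.
Variables (d : Order.disp_t) (V : finOrderType d) (G : sgraph V).

Lemma is_refined_chromatic_uniq (X Y : {poly {poly rat}}) :
  is_refined_chromatic G X -> is_refined_chromatic G Y -> X = Y.
Proof.
move=> HX HY; apply/eqP; rewrite -subr_eq0; apply/eqP.
set D := X - Y; set rs := [seq k%:R : {poly rat} | k <- iota 0 (size D)].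
apply: (@roots_geq_poly_eq0 _ D rs).
- apply/allP => _ /mapP[k _ ->].
  by rewrite rootE hornerD hornerN HX HY subrr.
- rewrite map_inj_uniq ?iota_uniq // => a b /eqP.
  by rewrite -!polyC_natr (inj_eq (@polyC_inj _)) eqr_nat => /eqP.
- by rewrite size_map size_iota.
Qed.

Definition binom_poly (m : nat) : {poly {poly rat}} :=
  ((m`!)%:R^-1 : rat)%:P%:P * \prod_(i < m) ('X - (i%:R)%:P).

Lemma horner_binom_poly (m k : nat) :
  (binom_poly m).[k%:R] = ('C(k, m))%:R.
Proof.
have ffactE : (\prod_(i < m) ('X - ((i%:R : {poly rat}))%:P)).[k%:R]
    = (k ^_ m)%:R.
  elim: m => [|m IH]; first by rewrite big_ord0 hornerC ffactn0.
  rewrite big_ord_recr hornerM IH hornerXsubC ffactnSr natrM.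
  case: (leqP m k) => [le_mk|lt_km]; first by rewrite natrB.
  by rewrite ffact_small // !mul0r.
rewrite /binom_poly hornerM hornerC ffactE -bin_ffact natrM mulrC -mulrA.
by rewrite -[(m`!)%:R]polyC_natr -polyCM mulfV ?mulr1 // pnatr_eq0 -lt0n fact_gt0.
Qed.

Definition surj_coloring_sum (k : nat) (A : {set 'I_k}) : {poly rat} :=
  \sum_(c : {ffun V -> 'I_k} | proper_coloring G c && (c @: setT == A))
     'X^(coloring_des G c).

Lemma surj_coloring_sumE (k : nat) (A : {set 'I_k}) :
  surj_coloring_sum A = surj_coloring_sum [set: 'I_#|A|].
Proof.
pose h (c : {ffun V -> 'I_#|A|}) : {ffun V -> 'I_k} :=
  [ffun v => Order.enum_val (c v)].
have h_inj : injective h.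
  move=> c c' /ffunP hE; apply/ffunP => v; have := hE v.
  by rewrite !ffunE => /Order.enum_val_inj.
pose S := [set c : {ffun V -> 'I_#|A|} |
             proper_coloring G c && (c @: setT == setT)].
have ltE (i j : 'I_#|A|) :
    (Order.enum_val i < Order.enum_val j)%N = (i < j)%N.
  have := leW_mono (@Order.le_enum_val _ _ (@le_total _ _) A) i j.
  by rewrite !ltEord.
have properE c : proper_coloring G (h c) = proper_coloring G c.
  apply: eq_forallb => i; apply: eq_forallb => j.
  by rewrite !ffunE (inj_eq (@Order.enum_val_inj _ _ A)).
have desE c : coloring_des G (h c) = coloring_des G c.
  by apply: eq_card => p; rewrite !inE !ffunE ltE.
transitivity (\sum_(c in h @: S) 'X^(coloring_des G c) : {poly rat}).
  apply: eq_bigl => c; apply/andP/imsetP => [[cP /eqP cA]|[c' + ->]].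
    have cv v : c v \in A by rewrite -cA imset_f.
    pose c' : {ffun V -> 'I_#|A|} :=
      [ffun v => Order.enum_rank_in (cv v) (c v)].
    have hc' : c = h c'.
      by apply/ffunP => v; rewrite !ffunE Order.enum_rankK_in.
    exists c' => //; rewrite inE -properE -hc' cP /=.
    apply/eqP/setP => i; rewrite inE; apply/imsetP.
    have := Order.enum_valP i; rewrite -{2}cA => /imsetP[v _ vE].
    exists v => //; apply: (@Order.enum_val_inj _ _ A).
    by rewrite vE hc' ffunE.
  rewrite inE properE => /andP[-> /eqP c'T]; split=> //.
  apply/eqP/setP => x; apply/imsetP/idP => [[v _ ->]|xA].
    by rewrite ffunE Order.enum_valP.
  have : Order.enum_rank_in xA x \in c' @: setT by rewrite c'T inE.
  case/imsetP=> v _ vE; exists v => //.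
  by rewrite ffunE -vE Order.enum_rankK_in.
rewrite big_imset /=; last by move=> c c' _ _ /h_inj.
by apply: eq_big => [c|c _]; rewrite ?inE ?desE.
Qed.

Lemma surj_coloring_sum_gt (k : nat) :
  (#|V| < k)%N -> surj_coloring_sum [set: 'I_k] = 0.
Proof.
move=> ltVk; apply: big1 => c /andP[_ /eqP cT]; exfalso.
have := leq_imset_card c [set: V].
by rewrite cT !cardsT card_ord leqNgt ltVk.
Qed.

Lemma refined_chromatic_exists :
  {X : {poly {poly rat}} | is_refined_chromatic G X}.
Proof.
exists (\sum_(m < #|V|.+1) (surj_coloring_sum [set: 'I_m])%:P * binom_poly m).
move=> k; pose N := maxn #|V| k.
pose F m : {poly rat} := surj_coloring_sum [set: 'I_m] *+ 'C(k, m).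
have F0 m : (#|V| < m)%N -> F m = 0.
  by move=> ltm; rewrite /F surj_coloring_sum_gt // mul0rn.
transitivity (\sum_(m < N.+1) F m).
  rewrite horner_sum (eq_bigr (fun m : 'I__ => F m)); last first.
    by move=> m _; rewrite hornerM hornerC horner_binom_poly mulr_natr.
  rewrite (big_ord_widen N.+1 F) ?ltnS ?leq_maxl // big_mkcond /=.
  apply: eq_bigr => m _; case: ifP => // /negbT.
  by rewrite -leqNgt => /F0.
rewrite /coloring_sum.
rewrite (partition_big (fun c : {ffun V -> 'I_k} => c @: setT) xpredT) //=.
have ltA (A : {set 'I_k}) : (#|A| < N.+1)%N.
  by rewrite ltnS (leq_trans (max_card _)) // card_ord leq_maxr.
rewrite (partition_big (fun A : {set 'I_k} => Ordinal (ltA A)) xpredT) //=.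
apply: eq_bigr => m _; rewrite /F.
rewrite -[X in 'C(X, _)]card_ord -card_draws -sumr_const.
apply: eq_big => [A|A]; first by rewrite inE -val_eqE.
rewrite inE => /eqP Am.
rewrite -[RHS]/(surj_coloring_sum A) (surj_coloring_sumE A).
by rewrite Am.
Qed.

Definition refined_chromatic : {poly {poly rat}} :=
  sval refined_chromatic_exists.

Lemma refined_chromaticP : is_refined_chromatic G refined_chromatic.
Proof. exact: svalP refined_chromatic_exists. Qed.

End RefinedChromatic.

(* Main.v *)
(** Directing each edge towards its larger color splits X_G(k) as the sum over
    acyclic orientations O of u^des(O) times the number N_O(k) of maps to
    {1, ..., k} that strictly increase along O, so it suffices to prove
    N_O(-1) = (-1)^n.  For a set U of vertices let N_U count the strictly
    increasing maps on U.  Removing the vertices of smallest color gives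
    N_U(k + 1) = \sum_S N_(U \ S)(k), over all sets S of sources of U.  At
    k = -1 the left side is N_U(0) = 0 for nonempty U, so by induction
    N_U(-1) = - (-1)^|U| \sum_(S != set0) (-1)^|S| = (-1)^|U|, because U has
    a source.  Polynomials in k are handled through their Newton series
    \sum_i a_i 'C(k, i), whose value at k = -1 is \sum_i a_i (-1)^i. *)
Require Import Defs.
From mathcomp Require Import all_boot all_order all_algebra.

Set Implicit Arguments.
Unset Strict Implicit.

Import GRing.Theory.
Local Open Scope ring_scope.

(** * Newton series and their value at -1 *)

Section NewtonSeries.
Variable R : comNzRingType.
Implicit Types (p : {poly R}) (b : R) (k : nat).

(* The coefficients are stored as a polynomial p, so that the value of the
   Newton series at k = -1 is p.[-1]. *)
Definition newton p k : R := \sum_(i < k.+1) p`_i *+ 'C(k, i).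

Lemma newton_sum (I : finType) (P : pred I) (p : I -> {poly R}) k :
  newton (\sum_(i | P i) p i) k = \sum_(i | P i) newton (p i) k.
Proof.
rewrite /newton exchange_big; apply: eq_bigr => j _ /=.
by rewrite coef_sum sumrMnl.
Qed.

Lemma newtonCM b p k : newton (b%:P * p) k = b * newton p k.
Proof.
rewrite /newton mulr_sumr; apply: eq_bigr => j _.
by rewrite coefCM mulrnAr.
Qed.

Lemma newton1 k : newton 1 k = 1.
Proof.
rewrite /newton big_ord_recl big1 => [|i _]; rewrite coef1 /= ?mul0rn //.
by rewrite bin0 addr0.
Qed.

Lemma newtonMX0 p : newton (p * 'X) 0 = 0.
Proof. by rewrite /newton big_ord1 coefMX mul0rn. Qed.

(* Multiplication by 'X is summation over k, by Pascal's rule. *)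
Lemma newtonMXS p k :
  newton (p * 'X) k.+1 = newton (p * 'X) k + newton p k.
Proof.
have E m : newton (p * 'X) m = \sum_(i < m) p`_i *+ 'C(m, i.+1).
  rewrite /newton big_ord_recl coefMX mul0rn add0r.
  by apply: eq_bigr => i _; rewrite coefMX.
(* The added top term has coefficient ['C(k, k.+1)] = 0; with equal ranges, Pascal's rule applies
   term by term. *)
have -> : newton (p * 'X) k = \sum_(i < k.+1) p`_i *+ 'C(k, i.+1).
  by rewrite E big_ord_recr /= bin_small // mulr0n addr0.
by rewrite E -big_split; apply: eq_bigr => i _; rewrite binS mulrnDr.
Qed.

End NewtonSeries.

(** The numerator at -1 is (-1)(-2)...(-m) = (-1)^m m!. *)
Lemma horner_binom_polyN1 (m : nat) : (binom_poly m).[-1] = (-1) ^+ m.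
Proof.
have E : (\prod_(i < m) ('X - ((i%:R : {poly rat}))%:P)).[-1]
    = (-1) ^+ m * (m`!)%:R.
  elim: m => [|m IH]; first by rewrite big_ord0 hornerC mulr1.
  rewrite big_ord_recr hornerM IH hornerXsubC factS natrM exprS -(natr1 m) /=.
  rewrite -opprD (addrC 1) mulrN mulN1r mulNr -mulrA.
  by rewrite (mulrC (m`!%:R)).
rewrite /binom_poly hornerM hornerC E mulrCA -(polyC_natr _ m`!) -polyCM.
by rewrite mulVf ?mulr1 // Num.Theory.pnatr_eq0 -lt0n fact_gt0.
Qed.

(** As [p] has finitely many coefficients, its Newton series is a genuine polynomial [Y] in lambda,
    and uniqueness identifies [Y] with the refined chromatic polynomial. *)
Lemma refined_chromatic_newton (d : Order.disp_t) (V : finOrderType d)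
    (G : sgraph V) (p : {poly {poly rat}}) :
  (forall k, coloring_sum G k = newton p k) ->
  (refined_chromatic G).[-1] = p.[-1].
Proof.
move=> pE; pose Y := \sum_(i < size p) (p`_i)%:P * binom_poly i.
have YP : is_refined_chromatic G Y.
  move=> k; rewrite pE /Y horner_sum /newton.
  pose F i := p`_i *+ 'C(k, i).
  have F0 i : (k < i)%N || (size p <= i)%N -> F i = 0.
    rewrite /F; case/orP=> [lt_ki | le_pi]; first by rewrite bin_small.
    by rewrite nth_default ?mul0rn.
  rewrite (eq_bigr (fun i : 'I__ => F i)) => [|i _]; last first.
    by rewrite hornerM hornerC horner_binom_poly mulr_natr.
  (* Both sums extend to the common range [N]: their missing terms vanish, by the binomial beyond
     [k] and by the coefficient beyond [size p]. *)
  pose N := maxn (size p) k.+1.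
  rewrite (big_ord_widen N F) ?leq_maxl //.
  rewrite (big_ord_widen N F) ?leq_maxr //.
  rewrite [LHS]big_mkcond [RHS]big_mkcond; apply: eq_bigr => i _.
  have [_|le_pi] := ltnP i (size p); have [_|lt_ki] := ltnP i k.+1 => //.
    by rewrite F0 ?lt_ki.
  by rewrite F0 ?le_pi ?orbT.
rewrite (is_refined_chromatic_uniq (refined_chromaticP G) YP) [RHS]horner_coef.
rewrite /Y horner_sum; apply: eq_bigr => i _.
by rewrite hornerM hornerC horner_binom_polyN1.
Qed.

(** Adding or removing a fixed element of [M] pairs its subsets with opposite signs. *)
Lemma sum_subset_sign (R : comNzRingType) (T : finType) (M : {set T}) :
  M != set0 -> \sum_(S : {set T} | S \subset M) (-1) ^+ #|S| = 0 :> R.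
Proof.
case/set0Pn=> v vM.
rewrite (bigID (fun S : {set T} => v \in S)) /=.
rewrite (reindex_onto (fun S => v |: S) (fun S => S :\ v)) /=; last first.
  by move=> S /andP[_ vS]; rewrite setD1K.
rewrite (eq_big (fun S : {set T} => (S \subset M) && (v \notin S))
                (fun S => - (-1) ^+ #|S|)) => [|S|S].
- by rewrite sumrN addNr.
- rewrite subUset sub1set vM setU11 /= andbT; congr (_ && _).
  apply/eqP/idP => [<-|vS]; first by rewrite setD11.
  by rewrite setU1K.
- case/andP=> _ /eqP SE; have vS : v \notin S by rewrite -SE setD11.
  by rewrite cardsU1 vS exprS mulN1r.
Qed.

(** * Counting strictly increasing labelings *)

Section StrictLabelings.
Variables (V : finType) (e : rel V).
Implicit Types (U S : {set V}) (k : nat).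

(* Maps U -> {1, ..., k} that strictly increase along e, extended by 0 outside
   of U; then e s t -> c s < c t holds for free when t is in U and s is not. *)
Definition labelings U k : {set {ffun V -> 'I_k.+1}} :=
  [set c : {ffun V -> 'I_k.+1} | [forall v, (0 < c v)%N == (v \in U)]
     && [forall s, forall t, e s t && (t \in U) ==> (c s < c t)%N]].

Lemma labelingsP U k (c : {ffun V -> 'I_k.+1}) :
  reflect ((forall v, (0 < c v)%N = (v \in U))
           /\ (forall s t, e s t -> t \in U -> (c s < c t)%N))
          (c \in labelings U k).
Proof.
rewrite inE; apply: (iffP andP) => [[/forallP cU /forallP cE] | [cU cE]].
  split=> [v|s t est tU]; first exact: eqP (cU v).
  by have /forallP/(_ t) := cE s; rewrite est tU.
split; apply/forallP => s; first by rewrite cU.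
by apply/forallP => t; apply/implyP => /andP[]; apply: cE.
Qed.

Definition sources U : {set V} := [set v in U | [forall w in U, ~~ e w v]].

Lemma sourcesP U v :
  reflect (v \in U /\ forall w, w \in U -> ~~ e w v) (v \in sources U).
Proof.
by rewrite inE; apply: (iffP andP) => -[vU vP]; split=> //; exact/forall_inP.
Qed.

Lemma labelings_set0 k : #|labelings set0 k| = 1%N.
Proof.
rewrite -(cards1 ([ffun=> ord0] : {ffun V -> 'I_k.+1})).
apply: eq_card => c; rewrite in_set1.
apply/labelingsP/eqP => [[c0 _] | ->].
  apply/ffunP => v; apply: val_inj; rewrite ffunE /=.
  by have := c0 v; rewrite inE; case: (nat_of_ord _).
by split=> [v|s t _]; rewrite ?ffunE inE.
Qed.

Lemma labelings_0 U : U != set0 -> #|labelings U 0| = 0%N.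
Proof.
case/set0Pn=> v vU; apply: eq_card0 => c; apply/negP => /labelingsP[cU _].
by have := cU v; rewrite vU ord1.
Qed.

Lemma labelings_succ U k :
  #|labelings U k.+1| =
  (\sum_(S : {set V} | S \subset sources U) #|labelings (U :\: S) k|)%N.
Proof.
pose bot (c : {ffun V -> 'I_k.+2}) := [set v | c v == 1%N :> nat].
rewrite -sum1_card (partition_big bot (fun S => S \subset sources U)) /=;
    last first.
  move=> c /labelingsP[cU cE]; apply/subsetP => v; rewrite inE => /eqP cv.
  have vU : v \in U by rewrite -cU cv.
  apply/sourcesP; split=> // w wU; apply/negP => /cE/(_ vU).
  by rewrite cv ltnS leqn0 => /eqP cw; have := cU w; rewrite wU cw.
apply: eq_bigr => S /subsetP SU; rewrite -sum1_card.
(* [up] raises the colors on [U] by one, so that [S], colored 0 by a labeling of [U :\: S], becomes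
   the class of color 1. *)
pose up (c : {ffun V -> 'I_k.+1}) : {ffun V -> 'I_k.+2} :=
  [ffun v => inord (c v + (v \in U))].
pose down (c : {ffun V -> 'I_k.+2}) : {ffun V -> 'I_k.+1} :=
  [ffun v => inord (c v).-1].
have upE c v : up c v = (c v + (v \in U))%N :> nat.
  rewrite ffunE inordK // -(addn1 k.+1).
  by apply: leq_add (ltn_ord _) _; case: (v \in U).
have downE c v : down c v = (c v).-1 :> nat.
  by rewrite ffunE inordK //; have := ltn_ord (c v); case: (nat_of_ord _).
rewrite (reindex_onto up down) => [|c /andP[/labelingsP[cU _] _]]; last first.
  apply/ffunP => v; apply: val_inj; rewrite /= upE downE -cU.
  by case: (nat_of_ord (c v)) => // m; rewrite addn1.
apply: eq_bigl => c.
apply/andP/labelingsP => [[/andP[/labelingsP[cU cE] /eqP cS] /eqP cK]|[cU cE]].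
  have c0 v : v \notin U -> c v = 0%N :> nat.
    move=> /negbTE vU; apply/eqP; rewrite -leqn0 leqNgt.
    by have := cU v; rewrite upE vU addn0 => ->.
  have SE v : v \in U -> (v \in S) = (c v == 0%N :> nat).
    by move=> vU; rewrite -cS inE upE vU addn1 eqSS.
  split=> [v | s t est].
    rewrite !inE; have [vU | /c0 ->] := boolP (v \in U); last by rewrite andbF.
    by rewrite SE // andbT lt0n.
  rewrite inE => /andP[tS tU]; have := cE s t est tU; rewrite !upE tU addn1 ltnS.
  have [_ | /c0 -> _] := boolP (s \in U); first by rewrite addn1.
  by rewrite lt0n -SE.
have c0 v : v \notin U -> c v = 0%N :> nat.
  move=> /negbTE vU; apply/eqP; rewrite -leqn0 leqNgt.
  by rewrite cU inE vU andbF.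
have SE v : v \in U -> (v \in S) = (c v == 0%N :> nat).
  by move=> vU; rewrite -[RHS]negbK -lt0n cU inE vU andbT negbK.
split; last first.
  apply/eqP/ffunP => v; apply: val_inj; rewrite /= downE upE.
  by have [_ | /c0 ->] := boolP (v \in U); rewrite ?addn1.
apply/andP; split.
  apply/labelingsP; split=> [v | s t est tU].
    rewrite upE; have [_ | /c0 ->] := boolP (v \in U) => //.
    by rewrite addn1.
  rewrite !upE tU addn1 ltnS; have [sU | /c0 -> //] := boolP (s \in U).
  (* An arc from [U] into [t] keeps [t] out of [S], whose members are sources of [U]. *)
  rewrite addn1; apply: cE => //; rewrite inE tU andbT.
  by apply/negP => /SU/sourcesP[_ /(_ s sU)]; rewrite est.
apply/eqP/setP => v; rewrite inE upE.
have [vU | vU] := boolP (v \in U); first by rewrite addn1 eqSS SE.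
rewrite c0 //=; apply/esym/negbTE; apply: contra vU.
by case/SU/sourcesP.
Qed.

Hypothesis e_acyclic : forall s : seq V, cycle e s -> s = [::].

(** A vertex [v] of [U] with fewest ancestors is a source: an arc from [w] in [U] to [v] would give
    [w] strictly fewer ancestors, since [v] is an ancestor of [w] only if there is a cycle. *)
Lemma sources_neq0 U : U != set0 -> sources U != set0.
Proof.
case/set0Pn=> v0 v0U; pose anc v := [set w | connect e w v].
have [v vU v_min] := @arg_minnP V v0 (mem U) (fun v => #|anc v|) v0U.
apply/set0Pn; exists v; apply/sourcesP; split=> // w wU; apply/negP => ewv.
have := v_min w wU; rewrite leqNgt => /negP; apply.
apply: proper_card; apply/properP; split.
  apply/subsetP => x; rewrite !inE => /connect_trans; apply; exact: connect1.
exists v; rewrite !inE ?connect0 //; apply/negP => /connectP[p ep wE].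
have : cycle e (v :: p) by rewrite /= rcons_path ep -wE.
by move/e_acyclic.
Qed.

Lemma labelings_newton (R : comNzRingType) U :
  exists p : {poly R},
    (forall k, #|labelings U k|%:R = newton p k) /\ p.[-1] = (-1) ^+ #|U|.
Proof.
have [m leUm] := ubnP #|U|; elim: m => // m IH in U leUm *.
have [->|U0] := eqVneq U set0.
  exists 1; split=> [k|]; first by rewrite labelings_set0 newton1.
  by rewrite hornerC cards0.
pose Q (S : {set V}) := (S \subset sources U) && (S != set0).
have subU S : S \subset sources U -> S \subset U.
  by move=> sS; apply: subset_trans sS _; apply/subsetP => v /sourcesP[].
(* The guard [Q S] is part of the chosen property, so that finite choice can range over all sets; 0
   is a filler where it fails. *)
have [S|P PE] := @fin_all_exists {set V} (fun=> {poly R}) (fun S p => Q S ->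
    (forall k, #|labelings (U :\: S) k|%:R = newton p k)
    /\ p.[-1] = (-1) ^+ #|U :\: S|).
  have [/andP[sS S0]|] := boolP (Q S); last by exists 0.
  have [|p pE] := IH (U :\: S); last by exists p.
  apply: (@leq_trans #|U|); last by rewrite -ltnS.
  apply: proper_card.
  rewrite properEneq subsetDl andbT; apply: contra_neq S0 => DE.
  apply/setP => v; rewrite inE; apply/negP => vS.
  by have /subsetP/(_ v vS) := subU S sS; rewrite -DE inE vS.
(* The term [S = set0] of the recursion is the count for [U] itself at [k], so the nonempty [S] give
   the forward difference; ['X] sums it up from the initial value 0. *)
exists ((\sum_(S | Q S) P S) * 'X); split=> [k|].
  elim: k => [|k IHk]; first by rewrite labelings_0 // newtonMX0.
  rewrite newtonMXS -IHk labelings_succ (bigD1 set0) ?sub0set //= setD0 natrD.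
  rewrite natr_sum newton_sum; congr (_ + _); apply: eq_bigr => S /PE[pE _].
  exact: pE.
rewrite hornerMX horner_sum.
have := sum_subset_sign R (sources_neq0 U0).
(* The signs of the nonempty [S] add up to -1, which cancels the factor -1 from ['X]. *)
rewrite (bigD1 set0) ?sub0set //= cards0 expr0 => /eqP; rewrite addr_eq0 => /eqP E.
rewrite (eq_bigr (fun S => (-1) ^+ #|U| * (-1) ^+ #|S|)) => [|S QS].
  by rewrite -mulr_sumr -mulrA mulrN1 -E mulr1.
have [_ ->] := PE S QS; have /andP[/subU sS _] := QS.
(* Only the parity matters, and there the truncated difference of cardinals becomes a sum. *)
rewrite cardsD (setIidPr sS) -signr_odd oddB ?subset_leq_card //.
by rewrite signr_addb !signr_odd.
Qed.

End StrictLabelings.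

Lemma card_labelings_setT (V : finType) (e : rel V) (k : nat) :
  #|labelings e setT k| =
  #|[set c : {ffun V -> 'I_k} | [forall s, forall t, e s t ==> (c s < c t)%N]]|.
Proof.
(* On [setT] the color 0 never occurs, so shifting the colors by one is a bijection. *)
pose h (c : {ffun V -> 'I_k}) : {ffun V -> 'I_k.+1} :=
  [ffun v => lift ord0 (c v)].
have h_inj : injective h.
  move=> c c' /ffunP hE; apply/ffunP => v; have := hE v.
  by rewrite !ffunE => /lift_inj.
rewrite -[RHS](card_imset _ h_inj); apply: eq_card => c.
apply/labelingsP/imsetP => [[cU cE] | [c' + ->]].
  have ltk v : ((c v).-1 < k)%N.
    by have := ltn_ord (c v); have := cU v; rewrite inE; case: (nat_of_ord _).
  have hc : c = h [ffun v => Ordinal (ltk v)].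
    apply/ffunP => v; apply: val_inj; rewrite !ffunE /= /bump /= add1n.
    by rewrite prednK // cU inE.
  exists [ffun v => Ordinal (ltk v)] => //; rewrite inE.
  apply/forallP => s; apply/forallP => t; apply/implyP => est.
  by rewrite !ffunE /= -ltnS !prednK ?cU ?inE ?cE ?inE.
rewrite inE => /forallP c'E; split=> [v|s t est _]; rewrite !ffunE ?inE //.
have /forallP/(_ t) := c'E s.
by rewrite est /= /bump /= !add1n ltnS.
Qed.

(** * Sorting colorings by the acyclic orientation they induce *)

Section ColoringOrientation.
Variables (d : Order.disp_t) (V : finOrderType d) (G : sgraph V) (k : nat).
Implicit Types (c : {ffun V -> 'I_k}) (O : {set V * V}).

Definition coloring_orientation c : {set V * V} :=
  [set p | G p.1 p.2 && (c p.1 < c p.2)%N].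

Lemma coloring_orientationP c :
  proper_coloring G c -> acyclic_orientation G (coloring_orientation c).
Proof.
move=> /forallP cP; apply/andP; split.
  apply/forallP => s; apply/forallP => t; rewrite !inE /=.
  have [Gst | //] := boolP (G s t); rewrite adj_sym Gst /= implybT /=.
  have /forallP/(_ t) := cP s; rewrite Gst -val_eqE /=.
  by case: ltngtP.
apply/acyclicP => -[//|x p] /= cyc.
(* Colors strictly increase around a directed cycle, so [x] would have a color below its own. *)
have : path (fun s t => c s < c t)%N x (rcons p x).
  by apply: sub_path cyc => s t; rewrite /Defs.arc /= inE => /andP[].
move/(order_path_min _) => H.
have /H : transitive (fun s t => c s < c t)%N by move=> ? ? ?; apply: ltn_trans.
by rewrite all_rcons ltnn.
Qed.

Lemma coloring_orientation_des c :
  orientation_des (coloring_orientation c) = coloring_des G c.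
Proof.
rewrite /orientation_des /coloring_des.
(* A coloring descent lists the smaller vertex first, whereas the matching arc starts at the larger
   vertex, which has the smaller color. *)
pose swap (p : V * V) := (p.2, p.1).
have swapK : involutive swap by case.
rewrite -[LHS](card_imset _ (inv_inj swapK)); apply: eq_card => -[i j].
apply/imsetP/idP => [[[s t] + ->]|].
  by rewrite !inE /= adj_sym => /andP[/andP[-> ->] ->].
rewrite inE /= => /and3P[Gij ltij ltc]; exists (j, i) => //.
by rewrite !inE /= adj_sym Gij ltc ltij.
Qed.

(** Every edge carries exactly one arc of [O]. Increase along arcs thus separates the ends of each
    edge, and the order of their colors recovers the arc. *)
Lemma coloring_orientation_eq O c : orientation G O ->
  proper_coloring G c && (coloring_orientation c == O)
  = [forall s, forall t, Defs.arc O s t ==> (c s < c t)%N].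
Proof.
move=> /forallP oO.
have OG s t : (s, t) \in O -> G s t.
  by move=> st; have /forallP/(_ t)/andP[/implyP/(_ st)] := oO s.
have OX s t : G s t -> ((s, t) \in O) (+) ((t, s) \in O).
  by move=> st; have /forallP/(_ t)/andP[_ /implyP/(_ st)] := oO s.
apply/andP/forallP => [[_ /eqP <-] s | cE].
  by apply/forallP => t; rewrite /Defs.arc /= inE; apply/implyP => /andP[].
have cO s t : (s, t) \in O -> (c s < c t)%N.
  by move=> st; have /forallP/(_ t)/implyP/(_ st) := cE s.
split.
  apply/forallP => s; apply/forallP => t; apply/implyP => /OX.
  rewrite -val_eqE neq_ltn; case: (boolP ((s, t) \in O)) => [/cO-> //|_ /=].
  by move/cO->; rewrite orbT.
apply/eqP/setP => -[s t]; rewrite inE /=.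
apply/andP/idP => [[/OX + lt_st] | st]; last by rewrite (OG _ _ st) cO.
case: (boolP ((s, t) \in O)) => //= _ /cO.
by rewrite ltnNge (ltnW lt_st).
Qed.

Lemma coloring_sum_orientations :
  coloring_sum G k =
    \sum_(O : {set V * V} | acyclic_orientation G O)
       'X^(orientation_des O) * #|labelings (Defs.arc O) setT k|%:R.
Proof.
rewrite /coloring_sum (partition_big coloring_orientation _
  coloring_orientationP); apply: eq_bigr => O /andP[oO _].
rewrite mulr_natr card_labelings_setT -sumr_const.
apply: eq_big => [c|c /andP[_ /eqP <-]].
  by rewrite inE coloring_orientation_eq.
by rewrite coloring_orientation_des.
Qed.

End ColoringOrientation.

Unset Implicit Arguments.
Set Strict Implicit.

Theorem theorem4p4 (n : nat) (d : Order.disp_t) (V : finOrderType d)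
    (hV : #|V| = n) (G : sgraph V) :
  (refined_chromatic G).[-1] =
    (-1) ^+ n *
      \sum_(O : {set V * V} | acyclic_orientation G O) 'X^(orientation_des O).
Proof.
(* The value at -1 is the same for every acyclic orientation, so only the weights survive in the
   sum; 0 is again a filler. *)
have [O|P PE] := @fin_all_exists {set V * V} (fun=> {poly {poly rat}})
    (fun O p => acyclic_orientation G O ->
      (forall k, #|labelings (Defs.arc O) setT k|%:R = newton p k)
      /\ p.[-1] = (-1) ^+ n).
  have [/andP[_ /acyclicP aO]|] := boolP (acyclic_orientation G O);
    last by exists 0.
  have [p] := labelings_newton aO {poly rat} setT.
  by rewrite cardsT hV => pE; exists p.
rewrite (@refined_chromatic_newton _ _ _
  (\sum_(O | acyclic_orientation G O) ('X^(orientation_des O))%:P * P O)).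
  rewrite horner_sum mulr_sumr; apply: eq_bigr => O /PE[_ pE].
  by rewrite hornerM hornerC pE mulrC.
move=> k; rewrite coloring_sum_orientations newton_sum.
by apply: eq_bigr => O /PE[pE _]; rewrite newtonCM pE.
Qed.
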